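(* Let $p$ be a prime. The minimal polynomial of $c_1$ over $\mathbb{F}_p$ is equal to $$X^{p^2}+(X^p-X-1)^{p-1}-X^p-2.$$ In particular, this polynomial is irreducible in $\mathbb{F}_p[X]$.
   Context: Fix a prime $p$ and an algebraic closure $E$ of $\mathbb{F}_p$. Let $c_0\in E$ be any chosen root of $X^p-X-1$, and let $c_1\in E$ be any chosen root of $X^p-X-c_0^{p-1}$. *)

(* Defs.v *)
From mathcomp Require Import all_boot all_order all_algebra.

Set Implicit Arguments.
Unset Strict Implicit.
Unset Printing Implicit Defensive.

Import GRing.Theory.
Local Open Scope ring_scope.

(* MathComp's [closedFieldType] only says that E is algebraically closed; an
   algebraic closure of F is moreover algebraic over F. *)
Definition algebraic_closure (F : fieldType) (E : closedFieldType)
    (iota : {rmorphism F -> E}) : Prop :=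
  forall x : E, algebraicOver iota x.

(* The monic generator of the ideal of polynomials over F vanishing at x.
   MathComp's [minPoly] requires a finite-dimensional extension, so it does not
   apply to an algebraic closure; the shape is that of [minCpolyP] for algC. *)
Definition is_minPoly (F E : fieldType) (iota : {rmorphism F -> E}) (x : E)
    (m : {poly F}) : Prop :=
  m \is monic /\ forall q : {poly F}, root (map_poly iota q) x = (m %| q).

Lemma is_minPoly_unique (F E : fieldType) (iota : {rmorphism F -> E}) (x : E)
    (m n : {poly F}) :
  is_minPoly iota x m -> is_minPoly iota x n -> m = n.
Proof.
move=> [mm Hm] [mn Hn]; apply/eqP; rewrite -eqp_monic //.
by rewrite /eqp -Hm Hn dvdpp -Hn Hm dvdpp.
Qed.

(* Main.v *)
(* Write Phi for the Frobenius of E.  Then Phi c0 = c0 + 1, so that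
   Phi^n c1 = c1 + sum_(i < n) (c0 + i)^(p-1), and the power sum over i < p
   equals -1; hence Phi^p c1 = c1 - 1.  If Phi^n c1 = c1, comparing Phi^(n+1) c1 with
   Phi c1 forces n to be a multiple p m of p, and then c1 - m = c1 forces p to
   divide m.  So c1 has p^2 distinct Frobenius conjugates, and the given
   polynomial, which is monic of degree p^2, vanishes at c1 because
   c1^p - c1 - 1 = 1/c0. *)
Require Import Defs.
From mathcomp Require Import all_boot all_order all_algebra.
From mathcomp Require Import ring.
Import GRing.Theory.
Local Open Scope ring_scope.

Lemma eqn_of_dvdn_sub (d i j : nat) :
  (j < d)%N -> (i <= j)%N -> (d %| j - i)%N -> i = j.
Proof.
move=> jd ij dv; apply/eqP; rewrite eqn_leq ij -subn_eq0 /=.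
apply: contraTT dv => ji.
by rewrite gtnNdvd ?lt0n // (leq_ltn_trans (leq_subr _ _)).
Qed.

Section CharacteristicP.

Variables (F : fieldType) (p : nat).
Hypothesis charFp : p \in [pchar F].

Local Notation Phi := (pFrobenius_aut charFp).

Let p_prime : prime p := pcharf_prime charFp.

Lemma pFrobenius_aut_inj : injective Phi.
Proof. exact: fmorph_inj. Qed.

(** Fermat's little theorem: Frobenius fixes the image of [n] in [F], so its [p]-th power is itself,
    and one factor cancels when that image is nonzero. *)
Lemma pchar_natrX_pred (n : nat) :
  (n%:R : F) ^+ p.-1 = (~~ (p %| n)%N)%:R.
Proof.
case: (boolP (p %| n)%N) => [|ndvd].
  rewrite (dvdn_pcharf charFp) => /eqP ->.
  by rewrite expr0n gtn_eqF // -ltnS prednK ?prime_gt0 // prime_gt1.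
have n0 : (n%:R : F) != 0 by rewrite -(dvdn_pcharf charFp).
apply: (mulIf n0).
by rewrite -exprSr prednK ?prime_gt0 // -(pFrobenius_autE charFp)
  pFrobenius_aut_nat mul1r.
Qed.

(* As a polynomial in x, the sum has degree less than p and is invariant
   under x -> x + 1, so it takes its value at 0 at p distinct points. *)
Lemma sum_shift_expr_pred (x : F) :
  \sum_(i < p) (x + i%:R) ^+ p.-1 = -1.
Proof.
have p_gt0 := prime_gt0 p_prime.
pose S (y : F) := \sum_(i < p) (y + i%:R) ^+ p.-1.
have S1 (y : F) : S (y + 1) = S y.
  apply/eqP; rewrite -subr_eq0 /S -sumrB.
  rewrite -(big_mkord xpredT
    (fun i => (y + 1 + i%:R) ^+ p.-1 - (y + i%:R) ^+ p.-1)).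
  (* The differences telescope to [(y + p%:R) ^+ p.-1 - y ^+ p.-1], and [p%:R] is zero in [F]. *)
  rewrite (telescope_sumr_eq (fun i => (y + i%:R) ^+ p.-1)) //.
    by rewrite (pcharf0 charFp) subrr.
  by move=> k _; rewrite -addrA -natr1 (addrC 1).
have Snat (n : nat) : S n%:R = S 0.
  by elim: n => // n IHn; rewrite -natr1 S1.
have S0 : S 0 = -1.
  (* The term at 0 vanishes and each of the other [p - 1] terms is 1 by Fermat, so the total is
     [p - 1], that is -1 in [F]. *)
  rewrite /S -(big_mkord xpredT (fun i => (0 + i%:R) ^+ p.-1)) big_ltn //.
  rewrite add0r pchar_natrX_pred dvdn0 add0r.
  rewrite (eq_big_nat _ _ (F2 := fun=> 1)) => [|i /andP[i_gt0 ip]].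
    by rewrite sumr_const_nat natrB // (pcharf0 charFp) sub0r.
  by rewrite add0r pchar_natrX_pred gtnNdvd.
pose P : {poly F} := \sum_(i < p) ('X + (i%:R)%:P) ^+ p.-1 + 1.
have PE (y : F) : P.[y] = S y + 1.
  rewrite hornerD hornerC horner_sum; congr (_ + _).
  by apply: eq_bigr => i _; rewrite horner_exp hornerD hornerX hornerC.
have size_term (i : 'I_p) : size (('X + (i%:R : F)%:P) ^+ p.-1) = p.
  by rewrite -[i%:R]opprK polyCN size_exp_XsubC prednK.
have P0 : P = 0.
  apply/eqP/negPn/negP => Pn0.
  pose rs : seq F := [seq i%:R | i <- iota 0 p].
  have rs_root : all (root P) rs.
    apply/allP => _ /mapP[i _ ->].
    by rewrite rootE PE Snat S0 addNr.
  have rs_uniq : uniq rs.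
    rewrite map_inj_in_uniq ?iota_uniq // => i j.
    rewrite !mem_iota !add0n /= => ip jp /eqP.
    wlog ij : i j ip jp / (i <= j)%N => [hw|].
      case/orP: (leq_total i j) => [|ji]; first exact: hw.
      by rewrite eq_sym => /(hw _ _ jp ip ji).
    rewrite eq_sym -subr_eq0 -natrB // -(dvdn_pcharf charFp).
    exact: eqn_of_dvdn_sub.
  have := max_poly_roots Pn0 rs_root rs_uniq.
  rewrite size_map size_iota ltnNge => /negP; apply.
  apply: (leq_trans (size_polyD _ _)); rewrite geq_max size_poly1 p_gt0 andbT.
  apply: (leq_trans (size_sum _ _ _)); apply/bigmax_leqP => i _.
  by rewrite size_term.
by apply/eqP; rewrite -subr_eq0 opprK -PE P0 horner0.
Qed.

Variable a : F.
Hypothesis a_root : Phi a = a + 1.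

(** Applying [Phi] shifts each [a + i] to [a + (i + 1)], and the leading [x] supplies the missing
    term at 0. *)
Lemma iter_pFrobenius_artin_schreier (x : F) (n : nat) :
  Phi x = x + a ^+ p.-1 ->
  iter n Phi x = x + \sum_(i < n) (a + i%:R) ^+ p.-1.
Proof.
move=> xE; elim: n => [|n IHn]; first by rewrite big_ord0 addr0.
rewrite iterS IHn rmorphD rmorph_sum /= xE -addrA big_ord_recl addr0.
congr (_ + (_ + _)); apply: eq_bigr => i _.
by rewrite rmorphXn rmorphD /= a_root rmorph_nat -addrA nat1r.
Qed.

(** Every block of [p] iterations adds a full power sum, which is -1; the next block starts from
    [x - m%:R], which satisfies the same equation as [x] because [Phi] fixes [m%:R]. *)
Lemma iter_mulp_pFrobenius (x : F) (m : nat) :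
  Phi x = x + a ^+ p.-1 -> iter (p * m) Phi x = x - m%:R.
Proof.
move=> xE; elim: m => [|m IHm]; first by rewrite muln0 subr0.
rewrite mulnS iterD IHm iter_pFrobenius_artin_schreier.
  by rewrite sum_shift_expr_pred -addrA -opprD natr1.
by rewrite rmorphB rmorph_nat /= xE addrAC.
Qed.

Lemma dvdn_pFrobenius_period (x : F) (n : nat) :
  Phi x = x + a ^+ p.-1 -> iter n Phi x = x -> (p ^ 2 %| n)%N.
Proof.
move=> xE xn.
have p_gt0 := prime_gt0 p_prime.
have powE (b : F) : Phi b = b + 1 -> b ^+ p.-1 * b = b + 1.
  by move=> <-; rewrite -exprSr prednK // pFrobenius_autE.
have aE := powE _ a_root.
have anE : (a + n%:R) ^+ p.-1 * (a + n%:R) = a + n%:R + 1.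
  by apply: powE; rewrite rmorphD /= a_root rmorph_nat addrAC.
(* The (n+1)-st iterate of [x] is [Phi x], but also the n-th iterate, again [x], plus the last term
   of the sum. *)
have powEn : (a + n%:R) ^+ p.-1 = a ^+ p.-1.
  have := iter_pFrobenius_artin_schreier x n.+1 xE.
  rewrite iterS xn big_ord_recr /= addrA.
  by rewrite -iter_pFrobenius_artin_schreier // xn xE => /addrI.
have pn : (p %| n)%N.
  (* Put [t = a ^+ p.-1]. Subtracting [t * a = a + 1] from [t * (a + n) = a + n + 1] gives
     [t * n = n]. If [n] is nonzero in [F], then [t = 1], whence [a = a + 1]. *)
  rewrite (dvdn_pcharf charFp); apply/negPn/negP => n0.
  have t1 : a ^+ p.-1 = 1.
    apply: (mulIf n0); rewrite mul1r.
    move: anE; rewrite powEn mulrDr aE -!addrA => /addrI.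
    by rewrite addrC => /addIr.
  move/eqP: aE; rewrite t1 mul1r -subr_eq0 opprD addrA subrr add0r oppr_eq0.
  by rewrite oner_eq0.
case/dvdnP: pn => m nE; move: xn; rewrite nE mulnC.
rewrite iter_mulp_pFrobenius // => /eqP.
rewrite -subr_eq0 addrAC subrr add0r oppr_eq0 -(dvdn_pcharf charFp) => pm.
by rewrite expnS expn1 dvdn_pmul2l.
Qed.

(** Iterates of [Phi] are injective, so a coincidence at [i <= j] makes [j - i] a period; it is
    below [p ^ 2] and divisible by it. *)
Lemma uniq_pFrobenius_conjugates (x : F) :
  Phi x = x + a ^+ p.-1 -> uniq (mkseq (fun n => iter n Phi x) (p ^ 2)).
Proof.
move=> xE; apply/mkseq_uniqP => i j.
rewrite !inE => ip jp.
wlog ij : i j ip jp / (i <= j)%N => [hw|].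
  case/orP: (leq_total i j) => [|ji]; first exact: hw.
  by move=> /esym /(hw _ _ jp ip ji).
rewrite -{1}(subnKC ij) iterD.
have iter_inj : injective (iter i Phi).
  by elim: i {ip ij} => // i IHi y z /= /pFrobenius_aut_inj /IHi.
move=> /iter_inj/esym/dvdn_pFrobenius_period => /(_ xE).
exact: eqn_of_dvdn_sub.
Qed.

End CharacteristicP.

(** Elements of the prime field are images of naturals, so Frobenius fixes the coefficients of
    [q]. *)
Lemma root_map_pFrobenius (p : nat) (E : fieldType)
    (iota : {rmorphism 'F_p -> E}) (charEp : p \in [pchar E])
    (q : {poly 'F_p}) (x : E) :
  root (map_poly iota q) x ->
  root (map_poly iota q) (pFrobenius_aut charEp x).
Proof.
have p_prime := pcharf_prime charEp.
move=> /rootP qx; apply/rootP.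
suff {1}-> : map_poly iota q =
    map_poly (pFrobenius_aut charEp) (map_poly iota q).
  by rewrite horner_map qx rmorph0.
rewrite -map_poly_comp; apply: eq_map_poly => a /=.
by rewrite -[a]natr_Zp !rmorph_nat.
Qed.

(** The power contributes degree at most [p * (p - 1)], and [p < p ^ 2], so ['X^(p ^ 2)]
    dominates. *)
Lemma size_monic_sum_Xp2 (R : idomainType) (p : nat) (p_gt1 : (1 < p)%N) :
  let f : {poly R} :=
    'X^(p ^ 2)%N + ('X^p - 'X - 1) ^+ p.-1 - 'X^p - 2%:R in
  (size f = (p ^ 2).+1) /\ f \is monic.
Proof.
move=> f.
pose r : {poly R} := ('X^p - 'X - 1) ^+ p.-1 - 'X^p - 2%:R.
have fE : f = 'X^(p ^ 2)%N + r by rewrite /f /r !addrA.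
have sz_as : (size ('X^p - 'X - 1 : {poly R})%R <= p.+1)%N.
  rewrite -addrA -opprD; apply: (leq_trans (size_polyD _ _)).
  rewrite geq_max size_polyXn leqnn size_polyN size_XaddC.
  by rewrite ltnS ltnW.
have sz_r : (size r <= p ^ 2)%N.
  apply: (leq_trans (size_polyD _ _)); rewrite geq_max; apply/andP; split.
    apply: (leq_trans (size_polyD _ _)); rewrite geq_max; apply/andP; split.
      apply: (leq_trans (size_poly_exp_leq _ _)).
      apply: (@leq_ltn_trans (p * p.-1)).
        by apply: leq_mul => //; rewrite -subn1 leq_subLR add1n.
      by rewrite expnS expn1 ltn_pmul2l ?prednK ?(ltnW p_gt1).
    rewrite size_polyN size_polyXn expnS expn1.
    by apply: (@leq_trans (p * 2)); rewrite ?leq_mul2l ?p_gt1 ?orbT //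
      muln2 -addnn -add1n leq_add2r ltnW.
  rewrite size_polyN -polyC_natr; apply: (leq_trans (size_polyC_leq1 _)).
  by rewrite expn_gt0 ltnW.
have lt_r : (size r < size ('X^(p ^ 2)%N : {poly R})%R)%N.
  by rewrite size_polyXn ltnS.
split; first by rewrite fE size_polyDl // size_polyXn.
by rewrite fE monicE lead_coefDl // lead_coefXn.
Qed.

(** In a factorization of [m], one factor vanishes at [x], hence is a multiple of [m]; by degree the
    other is constant. *)
Lemma is_minPoly_irreducible (F E : fieldType) (iota : {rmorphism F -> E})
    (x : E) (m : {poly F}) :
  is_minPoly iota x m -> irreducible_poly m.
Proof.
move=> [mm Hm]; have m0 := monic_neq0 mm.
have xm : root (map_poly iota m) x by rewrite Hm dvdpp.
split.
  rewrite ltnNge; apply/negP => /size1_polyC mE.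
  move: xm m0; rewrite mE map_polyC rootC fmorph_eq0 => /eqP ->.
  by rewrite eqxx.
move=> q q1 /[dup] qm /dvdpP[r mE].
have /norP[r0 q0] : ~~ ((r == 0) || (q == 0)) by rewrite -mulf_eq0 -mE.
move: xm; rewrite {1}mE rmorphM rootM !Hm => /orP[mr|mq].
  have := dvdp_leq r0 mr; rewrite mE size_mul // => le.
  case/negP: q1; rewrite eqn_leq lt0n size_poly_eq0 q0 andbT.
  rewrite -(leq_add2l (size r)) addn1.
  by rewrite (leq_trans (leqSpred _)).
by rewrite /eqp qm mq.
Qed.

Theorem corollary6p5 (p : nat) (p_prime : prime p)
    (E : closedFieldType) (iota : {rmorphism 'F_p -> E})
    (E_closure : algebraic_closure iota)
    (c0 c1 : E)
    (c0_root : root ('X^p - 'X - 1) c0)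
    (c1_root : root ('X^p - 'X - (c0 ^+ p.-1)%:P) c1) :
  is_minPoly iota c1
    ('X^(p ^ 2)%N + ('X^p - 'X - 1) ^+ p.-1 - 'X^p - 2%:R : {poly 'F_p})
  /\ irreducible_poly
    ('X^(p ^ 2)%N + ('X^p - 'X - 1) ^+ p.-1 - 'X^p - 2%:R : {poly 'F_p}).
Proof.
have p_gt0 := prime_gt0 p_prime.
have charEp : p \in [pchar E] by rewrite (fmorph_pchar iota) pchar_Fp.
pose Phi : {rmorphism E -> E} := pFrobenius_aut charEp.
have PhiE (x : E) : x ^+ p = Phi x by rewrite -(pFrobenius_autE charEp).
have c0E : Phi c0 = c0 + 1.
  move/rootP: c0_root; rewrite !hornerE PhiE => /eqP.
  by rewrite -addrA -opprD subr_eq0 => /eqP.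
have c1E : Phi c1 = c1 + c0 ^+ p.-1.
  move/rootP: c1_root; rewrite !hornerE PhiE => /eqP.
  by rewrite -addrA -opprD subr_eq0 => /eqP.
set f := (X in is_minPoly _ _ X).
have [sz_f f_monic] := size_monic_sum_Xp2 'F_p p (prime_gt1 p_prime).
rewrite -/f in sz_f f_monic.
have c0_neq0 : c0 != 0.
  apply/eqP => c00; move/eqP: c0E.
  by rewrite c00 rmorph0 add0r eq_sym oner_eq0.
have fc1 : root (map_poly iota f) c1.
  (* Multiplied by [c0], the left side becomes [c0 ^+ p - c0], which is 1. *)
  have dE : Phi c1 - c1 - 1 = c0^-1.
    apply: (mulIf c0_neq0); rewrite mulVf // c1E [c1 + _]addrC addrK mulrBl.
    by rewrite -exprSr prednK // PhiE c0E mul1r addrAC subrr add0r.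
  have PPhi : Phi (Phi c1) = Phi c1 + 1 + (c0 + 1)^-1.
    have := congr1 Phi dE; rewrite rmorphB rmorphB rmorph1 fmorphV /= c0E => <-.
    by ring.
  have dX : (c0^-1) ^+ p.-1 = c0 / (c0 + 1).
    have n0 : c0^-1 != 0 by rewrite invr_eq0.
    apply: (mulIf n0); rewrite -exprSr prednK // exprVn PhiE c0E.
    by rewrite mulrAC divff // mul1r.
  have c01 : c0 + 1 != 0 by rewrite -c0E fmorph_eq0.
  (* The value at [c1] is [Phi (Phi c1) + c0^-1 ^+ p.-1 - Phi c1 - 2], which reduces to
     [1 + 1 / (c0 + 1) + c0 / (c0 + 1) - 2 = 0]. *)
  apply/rootP.
  rewrite !(rmorphB, rmorphD, rmorphXn, rmorph1, rmorph_nat) /= map_polyX.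
  rewrite !hornerE expnS expn1 exprM !PhiE dE dX PPhi.
  by field.
have minf : is_minPoly iota c1 f.
  split=> // q; apply/idP/idP => [qc1|/dvdpP[r ->]]; last first.
    by rewrite rmorphM rootM fc1 orbT.
  have rc1 : root (map_poly iota (q %% f)) c1.
    move: qc1; rewrite {1}(divp_eq q f) rmorphD rmorphM /= !rootE !hornerE.
    by rewrite (rootP fc1) mulr0 add0r.
  (* A nonzero remainder would have degree below [p ^ 2] but vanish at the [p ^ 2] distinct
     conjugates of [c1]. *)
  rewrite /dvdp; apply/negPn/negP => r0.
  have m0 : map_poly iota (q %% f) != 0 by rewrite map_poly_eq0.
  have conj_root : all (root (map_poly iota (q %% f)))
      (mkseq (fun n => iter n Phi c1) (p ^ 2)).
    apply/allP => _ /mapP[n _ ->].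
    by elim: n => //= n; apply: root_map_pFrobenius.
  have := max_poly_roots m0 conj_root
    (uniq_pFrobenius_conjugates _ _ charEp _ c0E _ c1E).
  rewrite size_mkseq size_map_poly ltnNge -ltnS -sz_f ltn_modp.
  by rewrite monic_neq0.
by split=> //; apply: is_minPoly_irreducible minf.
Qed.
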